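(* Consider the pricing model described in the context with a single server ($C=1$), and any $\Lambda>0$, $\mu>0$ and regular $F$. Let $\pi^*$ be an optimal dynamic policy and $\tilde\lambda=\sum_{i\ge0}\lambda_i^*\mathbb{P}_i(\pi^* )$ its average arrival rate. Then the static policy $\pi^{\tilde\lambda,0}$ satisfies \[ \mathcal{Z}(\pi^{\tilde\lambda,0})\ \ge\ \tfrac12\,\mathcal{Z}(\pi^* ). \] Moreover, this analysis is tight: the factor $\tfrac12$ cannot be replaced by any larger constant (there are problem instances for which the ratio $\mathcal{Z}(\pi^{\tilde\lambda,0})/\mathcal{Z}(\pi^* )$ is arbitrarily close to $\tfrac12$).
   Context: Model: a service system with $C\ge 1$ identical parallel servers and one first-come-first-served queue of unlimited size. Potential customers arrive according to a Poisson process of rate $\Lambda>0$; each has a valuation drawn i.i.d. from a regular (in Myerson's sense) distribution $F$. A customer offered price $p$ joins iff their valuation is at least $p$, so the effective arrival rate is $\lambda(p)=\Lambda(1-F(p))$; this map is assumed to be a bijection between prices and rates, with inverse $p(\lambda)$, and $\lambda\mapsto\lambda p(\lambda)$ is concave. Service times are i.i.d. exponential with rate $\mu>0$, independent of valuations. The provider incurs a congestion cost $c>0$ per customer in the system per unit time. A policy $\pi$ is a sequence $(\lambda_0,\lambda_1,\dots)$ with $\lambda_i\in[0,\Lambda]$: with $i$ customers present the price $p(\lambda_i)$ is posted. The number in system is a birth–death process with birth rate $\lambda_i$ and death rate $\mu\min(i,C)$ in state $i$; when stable its stationary probabilities are $\mathbb{P}_i(\pi)=\prod_{k=0}^{i-1}\frac{\lambda_k}{\mu\min(k+1,C)}\big/\big(1+\sum_{n\ge0}\prod_{k=0}^{n}\frac{\lambda_k}{\mu\min(k+1,C)}\big)$.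 Revenue rate $\mathcal{R}(\pi)=\sum_{i}\lambda_i p(\lambda_i)\mathbb{P}_i(\pi)$; congestion cost $\mathcal{C}(\pi)=c\sum_i i\,\mathbb{P}_i(\pi)$ ($+\infty$ if unstable); objective $\mathcal{Z}(\pi)=\mathcal{R}(\pi)-\mathcal{C}(\pi)$. An optimal dynamic policy $\pi^*=(\lambda_0^*,\lambda_1^*,\dots)$ maximizes $\mathcal{Z}$ over all such policies. For a rate $\lambda$ and integer $\gamma\ge0$, the static (cutoff) policy $\pi^{\lambda,\gamma}$ uses arrival rate $\lambda$ in states $0,1,\dots,\gamma$ and arrival rate $0$ (no admission) in all states $\ge\gamma+1$. *)

(* Defs.v *)
From HB Require Import structures.
From mathcomp Require Export all_boot all_order all_algebra.
From mathcomp Require Export all_classical all_reals all_analysis.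

Set Implicit Arguments.
Unset Strict Implicit.
Unset Printing Implicit Defensive.

Import Order.TTheory GRing.Theory Num.Theory.
Import numFieldNormedType.Exports.

Local Open Scope classical_set_scope.
Local Open Scope ring_scope.

(* The valuation distribution is given as a probability measure V on R. *)
Definition valuation_cdf (R : realType)
    (V : probability (measurableTypeR R) R) (x : R) : R :=
  fine (V `]-oo, x]%classic).

Definition virtual_value (R : realType)
    (V : probability (measurableTypeR R) R) (f : R -> R) (x : R) : R :=
  x - (1 - valuation_cdf V x) / f x.

(* Myerson regularity.  The condition 0 < F x < 1 selects the interior of the
   support interval: densities may vanish, or be redefined, at its ends. *)
Definition regular_distribution (R : realType)
    (V : probability (measurableTypeR R) R) : Prop :=
  let F := valuation_cdf V in
  exists f : R -> R,
    [/\ measurable_fun setT f,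
        forall x, 0 <= f x,
        forall A : set (measurableTypeR R), measurable A ->
          V A = (\int[lebesgue_measure]_(x in A) (f x)%:E)%E,
        forall x, 0 < F x < 1 -> 0 < f x
      & forall x y, 0 < F x < 1 -> 0 < F y < 1 -> x <= y ->
          virtual_value V f x <= virtual_value V f y].

Definition effective_rate (R : realType) (Lambda : R)
    (V : probability (measurableTypeR R) R) (x : R) : R :=
  Lambda * (1 - valuation_cdf V x).

(* Prices are finite reals.  When the support of F is unbounded above, rate 0
   corresponds to the price +oo and is not attained at a finite price, so only
   the rates in ]0, Lambda] are required to be attained.  If rate 0 is not
   attained, price 0 is irrelevant: it only ever occurs in the product
   0 * price 0. *)
Record pricing_model (R : realType) := PricingModel {
  servers : nat;
  arrival_rate : R;                                     (* Lambda *)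
  service_rate : R;                                     (* mu *)
  congestion_cost_rate : R;                             (* c *)
  valuation : probability (measurableTypeR R) R;
  prices : set R;
  price : R -> R;                                       (* p(lambda) *)
  servers_gt0 : (0 < servers)%N;
  arrival_rate_gt0 : 0 < arrival_rate;
  service_rate_gt0 : 0 < service_rate;
  congestion_cost_rate_gt0 : 0 < congestion_cost_rate;
  valuation_regular : regular_distribution valuation;
  prices_interval : is_interval prices;
  effective_rate_inj :
    set_inj prices (effective_rate arrival_rate valuation);
  effective_rate_surj :
    set_surj prices `]0, arrival_rate]%classic
      (effective_rate arrival_rate valuation);
  effective_rateK : forall x, prices x ->
    price (effective_rate arrival_rate valuation x) = x;
  revenue_rate_concave :
    convex_function (E := R^o) `[0, arrival_rate]%classic
      (fun l : R^o => - (l * price l))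
}.

Section Policies.
Context {R : realType} (M : pricing_model R).
Implicit Types pi : nat -> R.

Definition is_policy pi : Prop := forall i, 0 <= pi i <= arrival_rate M.

Definition weight pi (i : nat) : R :=
  \prod_(k < i) (pi k / (service_rate M * (minn k.+1 (servers M))%:R)).

Local Open Scope ereal_scope.

Definition normalizer pi : \bar R := 1 + \sum_(0 <= n <oo) (weight pi n.+1)%:E.

Definition stable pi : Prop := normalizer pi < +oo.

(* If pi is not stable, then fine (normalizer pi) = 0 and this is 0. *)
Definition state_prob pi (i : nat) : R :=
  (weight pi i / fine (normalizer pi))%R.

Definition revenue pi : \bar R :=
  \sum_(0 <= i <oo) (pi i * price M (pi i) * state_prob pi i)%:E.

Definition congestion_cost pi : \bar R :=
  if `[< stable pi >] then
    (congestion_cost_rate M)%:E * \sum_(0 <= i <oo) (i%:R * state_prob pi i)%:E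
  else +oo.

Definition objective pi : \bar R := revenue pi - congestion_cost pi.

Definition optimal_policy pi : Prop :=
  is_policy pi /\ forall pi', is_policy pi' -> objective pi' <= objective pi.

Definition average_rate pi : R :=
  fine (\sum_(0 <= i <oo) (pi i * state_prob pi i)%:E).

End Policies.

Definition static_policy (R : realType) (l : R) (gamma : nat) : nat -> R :=
  fun i => if (i <= gamma)%N then l else 0.

(* Main.v *)
(* Let [h l = l p(l) - c l / mu] and let [l~] be the average rate of the optimal
   policy [pi].  Flow balance [lambda_i P_i = mu P_(i+1)] gives
   [l~ = mu (1 - P_0)], and since [sum_i i P_i >= 1 - P_0], Jensen's inequality for the
   concave revenue rate yields [Z(pi) <= h l~].  The cutoff policy earns exactly
   [h l~ / (1 + l~ / mu)], and [l~ / mu <= 1].  For tightness take valuations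
   uniform on [0, 1], [mu = 1], [c = 1/2] and [Lambda = 2 L (2 + L)]: the optimal
   policy is to admit at rate [L] only when idle, its average rate is
   [L / (1 + L)], and the ratio tends to [1/2] as [L] grows. *)
Require Import Defs.
From mathcomp Require Import ring lra.

Set Implicit Arguments.
Unset Strict Implicit.
Unset Printing Implicit Defensive.

Import Order.TTheory GRing.Theory Num.Theory.
Import numFieldNormedType.Exports.

Local Open Scope classical_set_scope.
Local Open Scope ring_scope.

(** * Real series, and their link to extended-real sums *)

Section Series.
Context {R : realType}.
Implicit Types (u v P : nat -> R) (l m : R).

(** The model is stated with extended-real sums; this moves them to real limits without any sign
    condition, as revenue terms may be negative. *)
Lemma eseries_EFin u l : series u @ \oo --> l ->
  (\sum_(0 <= i <oo) (u i)%:E)%E = l%:E.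
Proof.
move=> ul; apply/cvg_lim => //; apply: cvg_EFin.
  by apply: nearW => n; rewrite sumEFin.
apply: cvg_trans ul; apply: near_eq_cvg; apply: nearW => n.
by rewrite /= sumEFin.
Qed.

Lemma series_cvg_fine u : (forall i, 0 <= u i) ->
  (\sum_(0 <= i <oo) (u i)%:E < +oo)%E ->
  series u @ \oo --> fine (\sum_(0 <= i <oo) (u i)%:E)%E.
Proof.
move=> u0 uoo; have /cvg_ex[l ul] := nnseries_is_cvg u0 uoo.
by rewrite (eseries_EFin ul).
Qed.

Lemma cvg_seriesD u v l m : series u @ \oo --> l -> series v @ \oo --> m ->
  series (fun i => u i + v i) @ \oo --> l + m.
Proof.
move=> ul vm; apply: cvg_trans (cvgD ul vm); apply: near_eq_cvg.
by apply: nearW => n; rewrite /series/= big_split.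
Qed.

Lemma cvg_seriesZ u l m : series u @ \oo --> l ->
  series (fun i => m * u i) @ \oo --> m * l.
Proof.
move=> ul; apply: cvg_trans (cvgMl_tmp (a := m) ul); apply: near_eq_cvg.
by apply: nearW => n; rewrite /series/= mulr_sumr.
Qed.

Lemma cvg_seriesS u l : series (fun i => u i.+1) @ \oo --> l ->
  series u @ \oo --> u 0%N + l.
Proof.
move=> ul; rewrite -(cvg_shiftS (series u)).
apply: cvg_trans (cvgD (cvg_cst (u 0%N)) ul); apply: near_eq_cvg.
by apply: nearW => n; rewrite /series/= big_nat_recl.
Qed.

Lemma cvg_series_behead u l : series u @ \oo --> l ->
  series (fun i => u i.+1) @ \oo --> l - u 0%N.
Proof.
rewrite -(cvg_shiftS (series u)) => ul.
apply: cvg_trans (cvgB ul (cvg_cst (u 0%N))); apply: near_eq_cvg.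
apply: nearW => n.
rewrite -[LHS]/(series u n.+1 - u 0%N) /series/= big_nat_recl//=.
by rewrite addrC addKr.
Qed.

Lemma cvg_series_eq0 u n : (forall i, (n <= i)%N -> u i = 0) ->
  series u @ \oo --> \sum_(0 <= i < n) u i.
Proof.
move=> u0; apply: cvg_near_cst; near=> k.
have nk : (n <= k)%N by near: k; exact: nbhs_infty_ge.
rewrite /series/= (big_cat_nat (leq0n n) nk)//= [X in _ + X]big1_seq ?addr0// => i.
by rewrite mem_index_iota => /andP[_ /andP[ni _]]; exact: u0.
Unshelve. all: by end_near. Qed.

Lemma ler_series u v l m : series u @ \oo --> l -> series v @ \oo --> m ->
  (forall i, u i <= v i) -> l <= m.
Proof.
by move=> ul vm uv; apply: ler_cvg_to ul vm _; apply: nearW => n; exact: ler_sum.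
Qed.

Lemma series_ge_term u l i : (forall i, 0 <= u i) -> series u @ \oo --> l ->
  u i <= l.
Proof.
move=> u0 ul; rewrite -(cvg_lim _ ul)//.
have u_nd : nondecreasing_seq (series u).
  by apply: nondecreasing_series => n _ _; exact: u0.
apply: le_trans (nondecreasing_cvgn_le u_nd (cvgP _ ul) i.+1).
by rewrite /series/= big_nat_recr//= ler_wpDl// sumr_ge0.
Qed.

Lemma is_cvg_series_bounded u v l B : (forall i, 0 <= v i) ->
  (forall i, `|u i| <= B) -> series v @ \oo --> l ->
  cvgn (series (fun i => u i * v i)).
Proof.
move=> v0 uB vl; apply: normed_cvg; apply: (@series_le_cvg _ _ (fun i => B * v i)).
- by move=> i; exact: normr_ge0.
- by move=> i; apply: mulr_ge0 => //; exact: le_trans (uB i).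
- by move=> i; rewrite /= normrM (ger0_norm (v0 i)) ler_wpM2r.
- by apply: cvgP; exact: cvg_seriesZ vl.
Qed.

End Series.

(** * Concave functions on a segment and Jensen's inequality for series *)

Section Concave.
Context {R : realType}.
Implicit Types (a b m : R) (g : R -> R).

Definition concave_on a b g := forall t x y, 0 <= t <= 1 ->
  a <= x <= b -> a <= y <= b ->
  t * g x + (1 - t) * g y <= g (t * x + (1 - t) * y).

(** Write [m] as a convex combination of [x] and [y] with weight [(y - m) / (y - x)] on [x], then
    clear denominators. *)
Lemma concave_slopes a b g x m y : concave_on a b g ->
  a <= x -> x < m -> m < y -> y <= b ->
  (g y - g m) / (y - m) <= (g m - g x) / (m - x).
Proof.
move=> gC ax xm my yb.
have yx : 0 < y - x by lra.
have := gC ((y - m) / (y - x)) x y.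
have -> : (y - m) / (y - x) * x + (1 - (y - m) / (y - x)) * y = m.
  by field; rewrite gt_eqF.
have -> : (y - m) / (y - x) * g x + (1 - (y - m) / (y - x)) * g y =
  ((y - m) * g x + (m - x) * g y) / (y - x) by field; rewrite gt_eqF.
move=> h.
rewrite ler_pdivrMr ?subr_gt0// mulrAC ler_pdivlMr ?subr_gt0//.
suff : (y - m) * g x + (m - x) * g y <= g m * (y - x) by nra.
rewrite -ler_pdivrMr//; apply: h; [|lra|lra].
by rewrite divr_ge0 ?ler_pdivrMr ?mul1r//=; lra.
Qed.

(** The slope is the supremum of the right-hand slopes at [m]: it dominates each of them and, by
    [concave_slopes], is at most every left-hand slope. At an endpoint no finite slope need
    exist. *)
Lemma concave_supergradient a b g m : concave_on a b g -> a < m < b ->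
  exists s, forall x, a <= x <= b -> g x <= g m + s * (x - m).
Proof.
move=> gC /andP[am mb].
pose E := [set (g y - g m) / (y - m) | y in `]m, b]].
have Eub x : a <= x -> x < m -> ubound E ((g m - g x) / (m - x)).
  move=> ax xm _ [y /= + <-]; rewrite in_itv/= => /andP[my yb].
  exact: concave_slopes gC _ _ _ _.
have E0 : E !=set0 by eexists; exists b => //=; rewrite in_itv/= mb lexx.
exists (sup E) => x /andP[ax xb].
case: (ltgtP x m) => [xm|mx|->]; last by lra.
- have := ge_sup E0 (Eub _ ax xm); rewrite ler_pdivlMr ?subr_gt0//; nra.
- have Ex : E ((g x - g m) / (x - m)).
    by exists x => //=; rewrite in_itv/= mx xb.
  have := ub_le_sup (ex_intro _ _ (Eub _ (lexx a) am)) Ex.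
  rewrite ler_pdivrMr ?subr_gt0//; lra.
Qed.

(** The chord through the endpoints bounds [g] from below, a supergradient at the midpoint bounds it
    from above. *)
Lemma concave_bounded a b g : concave_on a b g -> a < b ->
  exists B, forall x, a <= x <= b -> `|g x| <= B.
Proof.
move=> gC ab; have [|s gs] := concave_supergradient (m := (a + b) / 2) gC; first lra.
have ba : 0 < b - a by rewrite subr_gt0.
exists (`|g a| + `|g b| + `|g ((a + b) / 2)| + `|s| * (b - a)) => x xab.
have := gs x xab.
have ->: x = (b - x) / (b - a) * a + (1 - (b - x) / (b - a)) * b.
  by field; rewrite gt_eqF.
set t := (b - x) / (b - a).
have t01 : 0 <= t <= 1.
  by rewrite /t divr_ge0 ?ler_pdivrMr ?mul1r//=; lra.
set y := t * a + _ => gy.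
have := gC t a b t01; rewrite !lexx (ltW ab) => /(_ isT isT).
rewrite -/y => gyl.
have ya : a <= y <= b by rewrite /y; nra.
have sy : s * (y - (a + b) / 2) <= `|s| * (b - a).
  apply: le_trans (ler_norm _) _; rewrite normrM ler_wpM2l// ler_norml; lra.
have := ler_norm (g ((a + b) / 2)).
have := lerNnormlW (lexx `|g a|); have := lerNnormlW (lexx `|g b|).
have := normr_ge0 (g a); have := normr_ge0 (g b).
have := normr_ge0 (g ((a + b) / 2)).
have sba : 0 <= `|s| * (b - a) by rewrite mulr_ge0// ltW.
rewrite ler_norml; set Ga := `|g a|; set Gb := `|g b|; set Gm := `|g _|.
move=> *; apply/andP; split; nra.
Qed.

(** Average a supergradient inequality taken at the mean [m]; a mean at an endpoint is treated
    separately. *)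
Lemma concave_jensen a b g (P x : nat -> R) m (l : R) : concave_on a b g ->
  (forall i, 0 <= P i) -> (forall i, a <= x i <= b) ->
  series P @ \oo --> (1 : R) -> series (fun i => x i * P i) @ \oo --> m ->
  series (fun i => g (x i) * P i) @ \oo --> l -> l <= g m.
Proof.
move=> gC P0 xab P1 xm gl.
have am : a <= m.
  rewrite -[a]mulr1; apply: (ler_series (cvg_seriesZ (m := a) P1) xm) => i.
  by rewrite ler_wpM2r//; case/andP: (xab i).
have mb : m <= b.
  rewrite -[b]mulr1; apply: (ler_series xm (cvg_seriesZ (m := b) P1)) => i.
  by rewrite ler_wpM2r//; case/andP: (xab i).
(* Summing this bound gives [g m], because the linear term has mean zero. *)
suff [s gs] : exists s, forall i, g (x i) * P i <=
    g m * P i + s * (x i * P i + - m * P i).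
  rewrite (_ : g m = g m * 1 + s * (m + - m * 1)); last by ring.
  apply: ler_series gl _ gs; apply: cvg_seriesD; first exact: cvg_seriesZ.
  apply/cvg_seriesZ/cvg_seriesD => //; exact: cvg_seriesZ.
have [mab|mNab] := pselect (a < m < b).
  have [s gs] := concave_supergradient gC mab; exists s => i.
  by have := ler_wpM2r (P0 i) (gs _ (xab i)); lra.
(* At an endpoint [m], all the mass sits on indices with [x i = m]. *)
suff xmE i : (x i - m) * P i = 0.
  exists 0 => i; have := xmE i => /eqP.
  by rewrite mulf_eq0 subr_eq0 => /orP[/eqP->|/eqP->]; rewrite ?mulr0; lra.
have d1 : series (fun i => (x i - m) * P i) @ \oo --> 0.
  rewrite (_ : (fun i => _) = fun i => x i * P i + - m * P i).
    rewrite (_ : 0 = m + - m * 1); last by lra.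
    by apply: cvg_seriesD => //; exact: cvg_seriesZ.
  by apply/funext => j; lra.
(* At [m = b] the terms are nonpositive; the sign change lets [series_ge_term] apply. *)
have d2 : series (fun i => -1 * ((x i - m) * P i)) @ \oo --> (-1 * 0 : R).
  exact: cvg_seriesZ.
have [ma|mb'] : m = a \/ m = b.
  have [->|ma] := eqVneq m a; [by left|right].
  apply/eqP; rewrite eq_le mb leNgt /=; apply/negP => mb'; apply: mNab.
  by rewrite mb' andbT lt_neqAle eq_sym ma.
- have := @series_ge_term _ _ _ i _ d1; have := xab i; have := P0 i.
  move=> Pi xi h; apply/eqP; rewrite eq_le h ?mulr_ge0; try lra.
  by move=> j; rewrite mulr_ge0//; have := xab j; lra.
- have := @series_ge_term _ _ _ i _ d2; have := xab i; have := P0 i.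
  move=> Pi xi h; apply/eqP; rewrite eq_le; apply/andP; split.
    by rewrite mulr_le0_ge0//; lra.
  have : -1 * ((x i - m) * P i) <= -1 * 0; last lra.
  by apply: h => j; have := xab j; have := P0 j; nra.
Qed.

End Concave.

(** * The single-server chain and the factor one half *)

Section SingleServer.
Context {R : realType} (M : pricing_model R) (M1 : servers M = 1%N).
Implicit Types pi : nat -> R.

Let Lambda := arrival_rate M.
Let mu := service_rate M.
Let c := congestion_cost_rate M.
Let mu_gt0 : 0 < mu := service_rate_gt0 M.
Let c_gt0 : 0 < c := congestion_cost_rate_gt0 M.
Let P pi := state_prob M pi.

Lemma revenue_rate_concave_on :
  concave_on 0 Lambda (fun l => l * price M l).
Proof.
move=> t x y /andP[t0 t1] x0L y0L.
have := @revenue_rate_concave _ M (Itv01 t0 t1) x y.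
rewrite !inE /= !in_itv /= => /(_ x0L y0L) h.
have : - ((t * x + (1 - t) * y) * price M (t * x + (1 - t) * y)) <=
  t * - (x * price M x) + (1 - t) * - (y * price M y) := h.
lra.
Qed.

Lemma weight0 pi : weight M pi 0 = 1.
Proof. by rewrite /weight big_ord0. Qed.

Lemma weightS pi i : weight M pi i.+1 = weight M pi i * (pi i / mu).
Proof.
rewrite /weight big_ord_recr/= (_ : minn i.+1 (servers M) = 1%N) ?mulr1//.
by rewrite M1; apply/minn_idPr.
Qed.

Lemma weight_ge0 pi i : is_policy M pi -> 0 <= weight M pi i.
Proof.
move=> pol; apply: prodr_ge0 => k _; have /andP[pi0 _] := pol k.
by rewrite divr_ge0// mulr_ge0// ltW.
Qed.

Lemma cvg_weight pi : is_policy M pi -> stable M pi ->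
  series (weight M pi) @ \oo --> fine (normalizer M pi).
Proof.
move=> pol; rewrite /stable /normalizer => st.
have wlt : (\sum_(0 <= n <oo) (weight M pi n.+1)%:E < +oo)%E.
  by move: st; rewrite !ltey; apply: contra_neq => ->; rewrite addey.
have w0 n := weight_ge0 n.+1 pol.
have wcvg := series_cvg_fine w0 wlt.
rewrite (eseries_EFin wcvg)/= -[1](weight0 pi).
exact: cvg_seriesS.
Qed.

Section StablePolicy.
Variable pi : nat -> R.
Hypotheses (pi_pol : is_policy M pi) (pi_st : stable M pi).

Lemma normalizer_gt0 : 0 < fine (normalizer M pi).
Proof.
apply: lt_le_trans (series_ge_term 0 _ (cvg_weight pi_pol pi_st)).
  by rewrite weight0.
by move=> i; exact: weight_ge0.
Qed.

Lemma state_prob_ge0 i : 0 <= P pi i.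
Proof. by rewrite divr_ge0 ?weight_ge0// ltW ?normalizer_gt0. Qed.

Lemma state_prob0_gt0 : 0 < P pi 0.
Proof. by rewrite /P /state_prob weight0 div1r invr_gt0 normalizer_gt0. Qed.

Lemma balance i : pi i * P pi i = mu * P pi i.+1.
Proof.
rewrite /P /state_prob weightS; field.
by rewrite !gt_eqF ?normalizer_gt0.
Qed.

Lemma cvg_state_prob : series (P pi) @ \oo --> (1 : R).
Proof.
rewrite -(mulVf (lt0r_neq0 normalizer_gt0)).
have := cvg_seriesZ (m := (fine (normalizer M pi))^-1) (cvg_weight pi_pol pi_st).
by under eq_fun do rewrite mulrC.
Qed.

Lemma cvg_rate :
  series (fun i => pi i * P pi i) @ \oo --> mu * (1 - P pi 0%N).
Proof.
rewrite (_ : (fun i => _) = fun i => mu * P pi i.+1).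
  exact: cvg_seriesZ (cvg_series_behead cvg_state_prob).
by apply/funext => i; exact: balance.
Qed.

Lemma average_rateE : average_rate M pi = mu * (1 - P pi 0%N).
Proof. by rewrite /average_rate (eseries_EFin cvg_rate). Qed.

(** By [balance], the holding cost of state [i.+1] can be charged to the admissions in state [i], at
    [c * i.+1 / mu] each, the cost of an expected sojourn. The objective becomes one real series
    over the admitting states. *)
Lemma objective_cvg :
  (\sum_(0 <= i <oo) (i%:R * P pi i)%:E < +oo)%E ->
  exists2 Z, objective M pi = Z%:E &
    series (fun i => (pi i * price M (pi i) - c * i.+1%:R * (pi i / mu)) *
                     P pi i) @ \oo --> Z.
Proof.
move=> Klt.
have Kcvg : series (fun i => i%:R * P pi i) @ \oo -->
    fine (\sum_(0 <= i <oo) (i%:R * P pi i)%:E)%E.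
  by apply: series_cvg_fine => // i; rewrite mulr_ge0// state_prob_ge0.
have [B gB] := concave_bounded revenue_rate_concave_on (arrival_rate_gt0 M).
have /cvg_ex[r rcvg] := is_cvg_series_bounded (u := fun i => pi i * price M (pi i))
  state_prob_ge0 (fun i => gB _ (pi_pol i)) cvg_state_prob.
move: Kcvg; set k := fine _ => Kcvg.
exists (r + - c * k).
  rewrite /objective /congestion_cost asboolT// /revenue (eseries_EFin rcvg).
  by rewrite (eseries_EFin Kcvg) -EFinM -EFinB mulNr.
rewrite (_ : (fun i => _) = (fun i => pi i * price M (pi i) * P pi i +
    - c * (i.+1%:R * P pi i.+1))); last first.
  apply/funext => i; rewrite -[P pi i.+1](mulKf (lt0r_neq0 mu_gt0)) -balance.
  by ring.
apply: cvg_seriesD rcvg (cvg_seriesZ _).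
(* The index shift loses nothing: state 0 holds no customer. *)
by have := cvg_series_behead Kcvg; rewrite mul0r subr0.
Qed.

End StablePolicy.

(** An infinite congestion cost forces the value [-oo], whatever the revenue. *)
Lemma objective_gtNy pi : (-oo < objective M pi)%E ->
  stable M pi /\ (\sum_(0 <= i <oo) (i%:R * P pi i)%:E < +oo)%E.
Proof.
rewrite /objective /congestion_cost; case: asboolP => [st|_]; last first.
  by rewrite addeNy ltxx.
move=> h; split=> //; move: h; rewrite !ltey; apply: contraTneq => ->.
by rewrite gt0_muley ?lte_fin// addeNy ltxx.
Qed.

Section StaticPolicy.
Variable l : R.
Hypothesis l_ge0 : 0 <= l.

Lemma weight_static i : weight M (static_policy l 0) i =
  if i is j.+1 then if j is 0 then l / mu else 0 else 1.
Proof.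
case: i => [|[|i]]; first exact: weight0.
  by rewrite weightS weight0 mul1r.
by rewrite weightS /static_policy/= mul0r mulr0.
Qed.

Lemma normalizer_static : normalizer M (static_policy l 0) = (1 + l / mu)%:E.
Proof.
rewrite /normalizer (@eseries_EFin _ _ (l / mu))//.
have := @cvg_series_eq0 R (fun n => weight M (static_policy l 0) n.+1) 1.
rewrite big_nat1 weight_static; apply=> -[|i]// _.
by rewrite weight_static.
Qed.

Lemma state_prob_static i : P (static_policy l 0) i =
  if i is j.+1 then if j is 0 then (l / mu) / (1 + l / mu) else 0
  else (1 + l / mu)^-1.
Proof.
rewrite /P /state_prob normalizer_static weight_static/=.
by case: i => [|[|i]]; rewrite ?div1r ?mul0r.
Qed.

Lemma stable_static : stable M (static_policy l 0).
Proof. by rewrite /stable normalizer_static ltry. Qed.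

Lemma objective_static : objective M (static_policy l 0) =
  ((l * price M l - c * (l / mu)) / (1 + l / mu))%:E.
Proof.
rewrite /objective /congestion_cost asboolT; last exact: stable_static.
rewrite /revenue; set pi := static_policy l 0.
(* Revenue comes from state 0 alone: elsewhere the rate is 0, so [price M 0] is multiplied by 0.
   Congestion needs the states 0 and 1, hence the cut at 2. *)
have rcvg := @cvg_series_eq0 R (fun i => pi i * price M (pi i) * P pi i) 1.
have kcvg := @cvg_series_eq0 R (fun i => i%:R * P pi i) 2.
rewrite (eseries_EFin (rcvg _)) => [|[|i]//]; last first.
  by rewrite /pi /static_policy /= !mul0r.
rewrite (eseries_EFin (kcvg _)) => [|[|[|i]]//]; last first.
  by rewrite state_prob_static mulr0.
rewrite big_nat1 big_nat_recl// big_nat1 !state_prob_static -EFinM -EFinB.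
by congr EFin; rewrite /pi /static_policy/= -/c; ring.
Qed.

End StaticPolicy.

Lemma static_is_policy l : 0 <= l <= Lambda -> is_policy M (static_policy l 0).
Proof.
by move=> lL [|i] //=; rewrite /static_policy/= lexx ltW ?arrival_rate_gt0.
Qed.

(** Never admitting anyone is a policy of value 0. *)
Lemma optimal_ge0 pi : optimal_policy M pi -> (0 <= objective M pi)%E.
Proof.
case=> _ /(_ (static_policy 0 0)); rewrite objective_static// !mul0r !mulr0 subr0 mul0r.
by apply; apply: static_is_policy; rewrite lexx ltW ?arrival_rate_gt0.
Qed.

Lemma objective_le pi : is_policy M pi -> (-oo < objective M pi)%E ->
  (objective M pi <= (average_rate M pi * price M (average_rate M pi) -
                      c * (average_rate M pi / mu))%:E)%E.
Proof.
move=> pol /objective_gtNy[st Klt]; set l := average_rate M pi.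
have [Z -> Zcvg] := objective_cvg pol st Klt; rewrite lee_fin.
have hC : concave_on 0 Lambda (fun x => x * price M x - c * (x / mu)).
  by move=> t x y t01 xL yL; have := revenue_rate_concave_on t01 xL yL; lra.
have [B hB] := concave_bounded hC (arrival_rate_gt0 M).
have /cvg_ex[z zcvg] := is_cvg_series_bounded (state_prob_ge0 pol st)
  (fun i => hB _ (pol i)) (cvg_state_prob pol st).
(* [z] charges each admission only [c / mu], as if nobody waited. The summand is then a fixed
   concave function of [pi i], and Jensen applies. *)
apply: (@le_trans _ _ z).
  apply: (ler_series Zcvg zcvg) => i; rewrite ler_wpM2r ?state_prob_ge0//.
  rewrite lerD2l lerN2 ler_wpM2r//.
    by rewrite divr_ge0// ?(ltW mu_gt0)//; case/andP: (pol i).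
  by rewrite ler_peMr ?(ltW c_gt0)// ler1n.
have lcvg := cvg_rate pol st; rewrite -average_rateE// -/l in lcvg.
exact: (concave_jensen hC (state_prob_ge0 pol st) pol (cvg_state_prob pol st) lcvg).
Qed.

Lemma static_half_optimal pi : optimal_policy M pi ->
  ((2^-1 : R)%:E * objective M pi <=
   objective M (static_policy (average_rate M pi) 0))%E.
Proof.
move=> opt; have pol := opt.1; have Z0 := optimal_ge0 opt.
have Zgt : (-oo < objective M pi)%E by apply: lt_le_trans Z0.
have := objective_le pol Zgt; have [st _] := objective_gtNy Zgt.
have lE := average_rateE pol st.
have P01 : P pi 0 <= 1.
  by apply: series_ge_term (cvg_state_prob pol st); exact: state_prob_ge0.
have P0gt := state_prob0_gt0 pol st.
set l := average_rate M pi in lE *.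
have lmu : l / mu = 1 - P pi 0 by rewrite lE mulrC mulKf// lt0r_neq0.
have l0 : 0 <= l by rewrite lE mulr_ge0 ?(ltW mu_gt0)// subr_ge0.
rewrite objective_static//; set h := _ - _ => Zh.
(* The sign of [h] matters: lowering the divisor from 2 to [1 + l / mu = 2 - P pi 0] must not
   decrease the quotient. *)
have h0 : 0 <= h by rewrite -lee_fin (le_trans Z0).
apply: le_trans (lee_wpmul2l _ Zh) _; first by rewrite lee_fin invr_ge0.
rewrite -EFinM lee_fin mulrC ler_wpM2l// lef_pV2 ?posrE//; rewrite lmu; lra.
Qed.

End SingleServer.

(** * Uniform valuations and tightness *)

Section UniformValuations.
Context {R : realType}.

Lemma valuation_cdf_homo (W : probability (measurableTypeR R) R) (x y : R) :
  x <= y -> valuation_cdf W x <= valuation_cdf W y.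
Proof.
move=> xy; apply: fine_le; rewrite ?fin_num_measure//.
by apply: le_measure; rewrite ?inE//; apply: subset_itvl; rewrite bnd_simp.
Qed.

Let V : probability (measurableTypeR R) R := uniform_prob (@ltr01 R).

Lemma uniform01_cdf (x : R) : 0 <= x <= 1 -> valuation_cdf V x = x.
Proof.
move=> /andP[x0 x1]; rewrite /valuation_cdf -[V _]/(uniform_prob ltr01 _) /uniform_prob.
rewrite integral_uniform_pdf (_ : _ `&` _ = `[0, x]%classic); last first.
  apply/seteqP; split=> y /=; rewrite !in_itv/=; first by case=> -> /andP[->].
  by move=> /andP[-> yx]; rewrite yx (le_trans yx).
rewrite (eq_integral (cst 1%:E)) => [|y]; last first.
  rewrite inE/= in_itv/= /uniform_pdf => /andP[-> yx].
  by rewrite (le_trans yx)// subr0 invr1.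
rewrite integral_cst//= mul1e lebesgue_measure_itv/= lte_fin.
case: ltP => [_|xle0]; first by rewrite sube0.
by apply/eqP; rewrite eq_le x0 xle0.
Qed.

(** Monotonicity and the values at 0 and 1 suffice, so the cdf is never computed outside the unit
    interval. *)
Lemma uniform01_cdf_interior (x : R) : 0 < valuation_cdf V x < 1 -> 0 < x < 1.
Proof.
move=> /andP[F0 F1]; apply/andP; split; rewrite ltNge; apply/negP => xle.
- have := valuation_cdf_homo V xle; rewrite (@uniform01_cdf 0) ?lexx ?ler01//.
  by rewrite leNgt F0.
- have := valuation_cdf_homo V xle; rewrite (@uniform01_cdf 1) ?lexx ?ler01//.
  by rewrite leNgt F1.
Qed.

Lemma uniform01_regular : regular_distribution V.
Proof.
have pdf1 (x : R) : 0 < x < 1 -> uniform_pdf 0 1 x = 1.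
  by move=> /andP[x0 x1]; rewrite /uniform_pdf !ltW// subr0 invr1.
exists (uniform_pdf 0 1); split => //.
- exact: measurable_uniform_pdf.
- by move=> x; exact: uniform_pdf_ge0.
- by move=> x /uniform01_cdf_interior /pdf1 ->.
(* On the interior the virtual value is [2 * x - 1]. *)
move=> x y /uniform01_cdf_interior x01 /uniform01_cdf_interior y01 xy.
by rewrite /virtual_value !pdf1// !uniform01_cdf; lra.
Qed.

Section Model.
Variables (Lambda mu c : R).
Hypotheses (Lambda_gt0 : 0 < Lambda) (mu_gt0 : 0 < mu) (c_gt0 : 0 < c).

Let rateE x : `[0, 1]%classic x -> effective_rate Lambda V x = Lambda * (1 - x).
Proof. by move=> /= x01; rewrite /effective_rate uniform01_cdf. Qed.

Let rate_inj : set_inj `[0, 1] (effective_rate Lambda V).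
Proof.
move=> x y; rewrite !inE => x01 y01; rewrite !rateE// => /(mulfI (lt0r_neq0 Lambda_gt0)).
lra.
Qed.

Let rate_surj : set_surj `[0, 1] `]0, Lambda] (effective_rate Lambda V).
Proof.
move=> l /=; rewrite in_itv/= => /andP[l0 lL].
have h : 0 <= 1 - l / Lambda <= 1.
  by rewrite subr_ge0 ler_pdivrMr// mul1r lL gerBl divr_ge0// ltW.
exists (1 - l / Lambda); first by rewrite /= in_itv.
by rewrite rateE ?in_itv//; field; rewrite gt_eqF.
Qed.

Let rateK x : `[0, 1]%classic x -> 1 - effective_rate Lambda V x / Lambda = x.
Proof. by move=> x01; rewrite rateE//; field; rewrite gt_eqF. Qed.

Let revenue_concave : convex_function (E := R^o) `[0, Lambda]
  (fun l : R^o => - (l * (1 - l / Lambda))).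
Proof.
move=> t x y _ _.
have t0 : 0 <= t%:num by []. have t1 : t%:num <= 1 by [].
rewrite -[X in X <= _]/(- ((t%:num * x + (1 - t%:num) * y) *
  (1 - (t%:num * x + (1 - t%:num) * y) / Lambda))).
rewrite -[X in _ <= X]/(t%:num * - (x * (1 - x / Lambda)) +
  (1 - t%:num) * - (y * (1 - y / Lambda))).
(* For a quadratic the concavity gap is explicit. *)
rewrite -subr_ge0 (_ : _ - _ = t%:num * (1 - t%:num) * (x - y) ^+ 2 / Lambda).
  by rewrite divr_ge0 ?(ltW Lambda_gt0)// mulr_ge0 ?sqr_ge0// mulr_ge0 ?subr_ge0.
by field; rewrite gt_eqF.
Qed.

(** The proofs determine the data: [ltn0Sn 0] fixes one server, and [rateK] the price
    [1 - l / Lambda] on [[0, 1]]. *)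
Definition uniform_model : pricing_model R :=
  PricingModel (ltn0Sn 0) Lambda_gt0 mu_gt0 c_gt0 uniform01_regular
    (@interval_is_interval _ `[0, 1]) rate_inj rate_surj rateK revenue_concave.

End Model.

(* With [c = mu / 2] and valuations at most 1, a customer who does not find the
   server idle costs at least what he pays, so admitting only when idle is best;
   this choice of [Lambda] makes [L] the best rate in state 0. *)
Lemma only_idle_optimal (L : R) (Lambda_gt0 : 0 < 2 * L * (2 + L))
    (c_gt0 : (0 : R) < 2^-1) : 0 < L ->
  optimal_policy (uniform_model Lambda_gt0 ltr01 c_gt0) (static_policy L 0).
Proof.
move=> L0; set M := uniform_model _ _ _.
have M1 : servers M = 1%N by [].
split; first by apply: static_is_policy; rewrite /M/=; nra.
move=> pi pol; have [Zgt|] := boolP (-oo < objective M pi)%E; last first.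
  by rewrite -leNgt leeNy_eq => /eqP ->; exact: leNye.
have [st Klt] := objective_gtNy Zgt.
have [Z -> Zcvg] := objective_cvg M1 pol st Klt.
rewrite objective_static ?(ltW L0)// lee_fin.
have P0 := state_prob_ge0 pol st.
have P1 : state_prob M pi 1 <= 1 - state_prob M pi 0.
  by apply: series_ge_term (cvg_series_behead (cvg_state_prob pol st)) => i.
have := balance M1 pol st 0; rewrite [service_rate M]/= mul1r => bal0.
have D0 : (2 * L * (2 + L)) != 0 by rewrite gt_eqF.
pose D := 2 * L * (2 + L).
have pi0 i : 0 <= pi i by case/andP: (pol i).
have LL : 2 + L != 0 /\ 1 + L != 0 by split; lra.
rewrite (_ : _ / _ = L / (2 * (2 + L))) /=; last first.
  by field; rewrite ?LL.1 ?LL.2 ?(gt_eqF L0).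
(* Statewise upper bound: an admission in state [i.+1] costs at least [i.+2 / 2 >= 1], and no price
   exceeds 1, so only state 0 can bring profit. *)
pose bound i := if i is 0%N then
  (pi 0%N * (1 - pi 0%N / D) - 2^-1 * pi 0%N) * state_prob M pi 0 else 0.
apply: (@le_trans _ _ (bound 0%N)).
  rewrite (_ : bound 0%N = \sum_(0 <= i < 1) bound i); last by rewrite big_nat1.
  apply: (ler_series Zcvg); first by apply: cvg_series_eq0 => -[].
  move=> [|i] /=; rewrite divr1 -/D ?mulr1//.
  rewrite mulr_le0_ge0// subr_le0.
  have : 0 <= pi i.+1 * (pi i.+1 / D) by rewrite mulr_ge0// divr_ge0// ltW.
  have : 2 <= i.+2%:R :> R by rewrite ler_nat.
  have := pi0 i.+1; set x := pi _; set q := x / D; set n := _%:R.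
  nra.
set v := L / _; rewrite /bound.
(* Completing the square, with [v] the claimed optimal value. By [bal0],
   [(1 + pi 0) * p = p + p1 <= 1], so the profit is at most [v]. *)
have -> : pi 0%N * (1 - pi 0%N / D) - 2^-1 * pi 0%N =
  v * (1 + pi 0%N) - (pi 0%N - L) ^+ 2 / D.
  by rewrite /v /D; field; rewrite LL.1 (gt_eqF L0).
have v0 : 0 <= v by rewrite divr_ge0//; lra.
have D_ge0 : 0 <= (pi 0%N - L) ^+ 2 / D by rewrite divr_ge0 ?sqr_ge0// ltW.
have := P0 0%N; move: bal0 P1 D_ge0; set p := state_prob M pi 0.
set p1 := state_prob M pi 1; set d := _ / D => bal0 P1 d0 p0.
have : (v * (1 + pi 0%N) - d) * p <= v * (p + p1).
  have := mulr_ge0 d0 p0; rewrite -bal0; lra.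
by move=> /le_trans; apply; rewrite ler_piMr//; lra.
Qed.

Lemma static_half_tight (kappa : R) : 2^-1 < kappa ->
  exists (M : pricing_model R) (pi : nat -> R),
    [/\ servers M = 1%N,
        optimal_policy M pi,
        (0 < objective M pi < +oo)%E
      & (objective M (static_policy (average_rate M pi) 0) <
         kappa%:E * objective M pi)%E].
Proof.
(* With this [L], [kappa] times the optimal value [L / (2 * (2 + L))] is exactly [1 / 4]. *)
move=> kappa_gt; pose L := (kappa - 2^-1)^-1.
have L0 : 0 < L by rewrite invr_gt0 subr_gt0.
have Lambda_gt0 : 0 < 2 * L * (2 + L) by rewrite !mulr_gt0//; lra.
have c_gt0 : (0 : R) < 2^-1 by lra.
have opt := only_idle_optimal Lambda_gt0 c_gt0 L0.
move: opt; set M := uniform_model _ _ _ => opt.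
have M1 : servers M = 1%N by [].
exists M, (static_policy L 0).
have LL : [/\ 2 + L != 0, 1 + L != 0, 1 + 2 * L != 0 & L != 0] by split; lra.
case: LL => L2 L1 L21 Ln0.
have -> : average_rate M (static_policy L 0) = L / (1 + L).
  rewrite average_rateE//; [|exact: opt.1|exact: stable_static M1 _].
  by rewrite state_prob_static//=; field.
have l0 : 0 <= L / (1 + L) by rewrite divr_ge0//; lra.
rewrite !objective_static// ?(ltW L0)//=.
have -> : (L * (1 - L / (2 * L * (2 + L))) - 2^-1 * (L / 1)) / (1 + L / 1) =
  L / (2 * (2 + L)) by field; rewrite L2 L1 Ln0.
split => //; first by rewrite lte_fin ltry andbT divr_gt0//; lra.
rewrite -EFinM lte_fin.
(* The bound drops the quadratic term [l ^ 2 / Lambda] of the revenue at [l = L / (1 + L)]; what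
   remains is [(l / 2) / (1 + l)], which is below [1 / 4]. *)
apply: (@le_lt_trans _ _ (L / (2 * (1 + 2 * L)))).
  rewrite -subr_ge0 (_ : _ - _ = (L / (1 + L)) ^+ 2 / (2 * L * (2 + L)) / (1 + L / (1 + L))).
    by rewrite divr_ge0 ?divr_ge0 ?sqr_ge0// ?(ltW Lambda_gt0)//; lra.
  by field; rewrite L1 L2 Ln0 andbT; lra.
have -> : kappa = 2^-1 + L^-1 by rewrite /L invrK; lra.
rewrite -subr_gt0 (_ : _ - _ = 1 / (4 * (1 + 2 * L))).
  by rewrite divr_gt0 ?mulr_gt0//; lra.
by field; rewrite L2 L21 Ln0.
Qed.

End UniformValuations.

Theorem theorem1 (R : realType) :
  (forall (M : pricing_model R) (pi : nat -> R),
     servers M = 1%N -> optimal_policy M pi ->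
     ((2^-1 : R)%:E * objective M pi <=
      objective M (static_policy (average_rate M pi) 0))%E)
  /\
  (forall kappa : R, 2^-1 < kappa ->
     exists (M : pricing_model R) (pi : nat -> R),
       [/\ servers M = 1%N,
           optimal_policy M pi,
           (0 < objective M pi < +oo)%E
         & (objective M (static_policy (average_rate M pi) 0) <
            kappa%:E * objective M pi)%E]).
Proof.
split=> [M pi M1 opt|kappa]; first exact: static_half_optimal.
exact: static_half_tight.
Qed.
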